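(* Let $f:\mathbb{C}\to\mathbb{C}$ be a non-constant polynomial and $c\in\mathbb{C}$. There exists $R=R(c)>1$ such that $$\mathcal{K}_c=\bigcap_{n=0}^{+\infty} f_n^{-1}\left(\overline{\mathbb{D}(0,R)}\right).$$
   Context: The sequence $(f_n)_{n\ge 0}$ is defined by $f_0(z)=z$, $f_1(z)=f(z)$, and $f_n(z)=f_{n-1}(z)f_{n-2}(z)+c$ for $n\ge 2$. The filled-in Julia set is $\mathcal{K}_c=\{z\in\mathbb{C}:\sup_{n\in\mathbb{N}}|f_n(z)|<+\infty\}$. $\overline{\mathbb{D}(0,R)}$ is the closed disk of radius $R$ centered at $0$. The polynomial $f$ is fixed, so $R$ may also depend on $f$. *)

(* Defs.v *)
(* The complex numbers are [R[i]], for [R : realType]. *)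
From mathcomp Require Import all_boot all_order all_algebra.
From mathcomp Require Import all_classical all_reals all_analysis.
From mathcomp Require Import complex.
Set Implicit Arguments.
Unset Strict Implicit.
Unset Printing Implicit Defensive.
Import Order.TTheory GRing.Theory Num.Theory.
Import ComplexField.Normc.
Local Open Scope classical_set_scope.
Local Open Scope ring_scope.

Fixpoint fib_iter (R : realType) (f : R[i] -> R[i]) (c : R[i]) (n : nat)
    (z : R[i]) : R[i] :=
  match n with
  | 0 => z
  | 1 => f z
  | (m.+1 as k).+1 => fib_iter f c k z * fib_iter f c m z + c
  end.

(* [normc] is the [R]-valued modulus, whereas [`|z|] on [R[i]] takes its
   values in [R[i]]. *)
Definition filled_julia (R : realType) (f : R[i] -> R[i]) (c : R[i]) :
    set R[i] :=
  [set z | (ereal_sup (range (fun n : nat => (normc (fib_iter f c n z))%:E))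
            < +oo)%E].

Definition closed_disk (R : realType) (a : R[i]) (r : R) : set R[i] :=
  closed_ball_ (@normc R) a r.

(* Main.v *)
(** Two consecutive terms of modulus at least [T = 2 + |c|] force the moduli to
    grow at least linearly from there on.  Since a non-constant polynomial tends
    to infinity at infinity, this bounds [z], hence also [f z], for every [z]
    with a bounded orbit.  Take [R] larger than these two bounds and than
    [2T + 2|c|].  If [f_(n+2)] were the first term of modulus [> R], then
    [|f_n| <= R] gives [|f_(n+1)| >= (R - |c|) / R >= 1/2], so
    [|f_(n+3)| >= R/2 - |c| >= T]; the two consecutive terms [f_(n+2)] and
    [f_(n+3)] then make the orbit unbounded. *)
Require Import Defs.
From mathcomp Require Import all_boot all_order all_algebra.
From mathcomp Require Import all_classical all_reals all_analysis.
From mathcomp Require Import complex lra.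
Import Order.TTheory GRing.Theory Num.Theory.
Import ComplexField.Normc.
Local Open Scope classical_set_scope.
Local Open Scope ring_scope.

Lemma normc_ge0 (R : rcfType) (x : R[i]) : 0 <= normc x.
Proof. by case: x => a b; rewrite /= sqrtr_ge0. Qed.

Lemma normc_gt0 (R : rcfType) (x : R[i]) : x != 0 -> 0 < normc x.
Proof.
move=> x0; rewrite lt_neqAle normc_ge0 andbT eq_sym.
by apply: contra x0 => /eqP /eq0_normc ->.
Qed.

Lemma ler_normcD (R : rcfType) (x y : R[i]) :
  normc (x + y) <= normc x + normc y.
Proof. exact: le_normcD. Qed.

Lemma lerB_normcD (R : rcfType) (x y : R[i]) :
  normc x - normc y <= normc (x + y).
Proof.
have := ler_normcD _ (x + y) (- y).
by rewrite addrK (normcN y : normc (- y) = _) lerBlDr.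
Qed.

Lemma poly_normc_bounded (R : rcfType) (p : {poly R[i]}) (rho : R) :
  exists M : R, forall z, normc z <= rho -> normc p.[z] <= M.
Proof.
elim/poly_ind: p => [|p a [M HM]].
  by exists 0 => z _; rewrite horner0 normc0.
exists (M * rho + normc a) => z hz; rewrite hornerMXaddC.
apply: le_trans (ler_normcD _ _ _) _; rewrite lerD2r normcM.
by apply: ler_pM; rewrite ?normc_ge0 ?HM.
Qed.

(** In the Horner step the extra factor [z] already tends to infinity, so a positive lower bound [e]
    on [normc p.[z]] for large [z] is enough. A nonzero constant [p] gives its own modulus as [e];
    otherwise the induction hypothesis gives [1]. *)
Lemma poly_normc_coercive (R : rcfType) (p : {poly R[i]}) : (1 < size p)%N ->
  forall T : R, exists rho : R, forall z, rho < normc z -> T <= normc p.[z].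
Proof.
elim/poly_ind: p => [|p a IH]; first by rewrite size_poly0.
rewrite size_MXaddC; case: ifP => // _; rewrite ltnS => p0 T.
suff [e e0 [rho He]] : exists2 e : R, 0 < e &
    exists rho : R, forall z, rho < normc z -> e <= normc p.[z].
  exists (Num.max rho ((T + normc a) / e)) => z.
  rewrite gt_max ltr_pdivrMr // => /andP[/He ez hz].
  rewrite hornerMXaddC; apply: le_trans _ (lerB_normcD _ _ _).
  rewrite lerBrDr normcM (le_trans (ltW hz)) // mulrC.
  by rewrite ler_wpM2r // normc_ge0.
have [p1|p1] := leqP (size p) 1.
  have /size_poly1P[b b0 ->] : size p == 1%N by rewrite eqn_leq p1 p0.
  exists (normc b); first exact: normc_gt0.
  by exists 0 => z _; rewrite hornerC.
by exists 1 => //; exact: IH.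
Qed.

Section Recurrence.
Variables (R : realType) (c : R[i]) (u : nat -> R[i]).
Hypothesis uS : forall n, u n.+2 = u n.+1 * u n + c.
Let T : R := 2 + normc c.

Lemma escape (n : nat) : T <= normc (u n) -> T <= normc (u n.+1) ->
  forall B : R, exists m, B < normc (u m).
Proof.
move=> h0 h1 B.
(* If [y] is the modulus of the later term, the next modulus is at least [T * y - normc c]. As
   [y >= 1], this is at least [2 * y], hence at least [y + 1]. *)
have growth k : T <= normc (u (k + n)) /\ T + k%:R <= normc (u (k + n).+1).
  elim: k => [|k [IH0 IH1]]; first by rewrite addr0.
  have k0 : 0 <= k%:R :> R by rewrite ler0n.
  have := lerB_normcD _ (u (k + n).+1 * u (k + n)) c.
  rewrite addSn uS normcM -natr1; have := normc_ge0 _ c.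
  by move: IH0 IH1; rewrite /T => *; split; nra.
exists (Num.bound `|B| + n).+1.
have [_] := growth (Num.bound `|B|); apply: lt_le_trans.
apply: (le_lt_trans (ler_norm B)).
apply: (lt_le_trans (archi_boundP (normr_ge0 B))).
by rewrite ler_wpDl // /T; have := normc_ge0 _ c; lra.
Qed.

Lemma bounded_orbit_le (r B : R) : 2 * T + 2 * normc c <= r ->
  normc (u 0%N) <= r -> normc (u 1%N) <= r -> (forall n, normc (u n) <= B) ->
  forall n, normc (u n) <= r.
Proof.
move=> hr h0 h1 hB n.
(* The recurrence looks two terms back, so the induction carries two consecutive bounds. *)
suff [] : normc (u n) <= r /\ normc (u n.+1) <= r by [].
elim: n => [//|n [IH0 IH1]]; split=> //; rewrite leNgt; apply/negP => lt_r.
have c0 := normc_ge0 _ c; have a0 := normc_ge0 _ (u n).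
have half : 1 / 2 <= normc (u n.+1).
  have := ler_normcD _ (u n.+1 * u n) c; rewrite -uS normcM.
  by move: hr; rewrite /T => *; nra.
have big : T <= normc (u n.+3).
  have := lerB_normcD _ (u n.+2 * u n.+1) c; rewrite -uS normcM.
  by move: hr; rewrite /T => *; nra.
have [|m] := escape n.+2 _ big B; first by move: hr; rewrite /T; lra.
by rewrite ltNge hB.
Qed.

End Recurrence.

Lemma filled_juliaP (R : realType) (f : R[i] -> R[i]) (c z : R[i]) :
  filled_julia f c z <-> exists B : R, forall n, normc (fib_iter f c n z) <= B.
Proof.
rewrite /filled_julia /=; split=> [|[B hB]]; last first.
  apply: (@le_lt_trans _ _ B%:E); last exact: ltry.
  by apply: ge_ereal_sup => _ [n _ <-]; rewrite lee_fin.
set s := ereal_sup _ => s_fin.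
have hs n : ((normc (fib_iter f c n z))%:E <= s)%E.
  by apply: ereal_sup_ubound; exists n.
(* [fine s] is the true supremum: [+oo] is excluded by [s_fin], and [-oo] by a real term lying below
   [s]. *)
exists (fine s) => n; move: (hs n) s_fin.
by case: s {hs} => [s| |] //=; rewrite ?lee_fin ?leeNy_eq.
Qed.

Lemma mem_closed_disk0 (R : realType) (r : R) (z : R[i]) :
  closed_disk 0 r z <-> normc z <= r.
Proof.
by rewrite /closed_disk /closed_ball_ /= sub0r (normcN z : normc (- z) = _).
Qed.

Theorem proposition2p1 (R : realType) (p : {poly R[i]}) (c : R[i]) :
  (1 < size p)%N ->
  exists r : R, 1 < r /\
    filled_julia (horner p) c =
    \bigcap_(n in [set: nat]) (fib_iter (horner p) c n @^-1` closed_disk 0 r).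
Proof.
move=> p1; pose T : R := 2 + normc c.
have [rho0 hrho0] := poly_normc_coercive _ _ p1 T.
(* Beyond radius [rho], both [z] and [p.[z]] have modulus at least [T], so [escape] applies at index
   0. *)
pose rho := Num.max rho0 T.
have [M hM] := poly_normc_bounded _ p rho.
(* The first entry is the threshold of [bounded_orbit_le] and makes [r] exceed 1; [rho] and [M]
   cover its two initial terms. *)
pose r := Num.max (2 * T + 2 * normc c) (Num.max rho M).
have uS z n : fib_iter (horner p) c n.+2 z =
  fib_iter (horner p) c n.+1 z * fib_iter (horner p) c n z + c by [].
exists r; split.
  by rewrite /r lt_max /T; apply/orP; left; have := normc_ge0 _ c; lra.
apply/seteqP; split=> z.
  move=> /filled_juliaP[B hB] n _; apply/mem_closed_disk0.
  have z_le : normc z <= rho.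
    rewrite leNgt; apply/negP; rewrite gt_max => /andP[/hrho0 fT zT].
    have [m] := escape _ _ _ (uS z) 0 (ltW zT) fT B.
    by rewrite ltNge hB.
  apply: (bounded_orbit_le _ _ _ (uS z) _ B) => //=.
  - by rewrite /r le_max lexx.
  - by rewrite /r 2!le_max z_le orbT.
  - by rewrite /r 2!le_max hM // !orbT.
by move=> hz; apply/filled_juliaP; exists r => n; apply/mem_closed_disk0/hz.
Qed.
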